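(* There exist constants $0<c<C<\infty$ and $\gamma>0$ such that for every integer $n\ge 2$ the harmonic sorter on lists of length $n$ satisfies the following, where $\tau_x$ denotes its sorting time started from the list $x$. (Upper bound) For every list $x$ of length $n$, $\mathbb E[\tau_x]\le C n(\log n)^2$ and $\mathbb P(\tau_x> C n(\log n)^2)\le C n^{-\gamma}$. (Lower bound) There is a list $x$ of length $n$ with $\mathbb E[\tau_x]\ge c\, n(\log n)^2$ and $\mathbb P(\tau_x< c\, n(\log n)^2)\le C n^{-\gamma}$. That is, the harmonic sorter requires order $n(\log n)^2$ comparisons to sort a length-$n$ list in the worst case, both in expectation and with polynomially small failure probability.
   Context: Write $[n]=\{0,1,\dots,n-1\}$. A list of length $n$ is a sequence $x=(x(i))_{i\in[n]}$ with values in a totally ordered set; it is sorted if $x(0)\le x(1)\le\dots\le x(n-1)$. To sort a pair of positions $\{i,j\}$ with $i<j$ means: swap the entries at positions $i$ and $j$ if the entry in position $i$ is larger than the entry in position $j$, and otherwise do nothing. The harmonic sorter uses the weights $w(\{i,j\})=1/|j-i|$ for distinct $i,j\in[n]$: a single step (comparison) chooses a pair $\{i,j\}$, independently of the past, with probability $w(\{i,j\})/\sum_{e}w(e)$ (sum over all unordered pairs $e$ of distinct elements of $[n]$), and sorts that pair. The sorting time $\tau_x$ is the number of steps (comparisons) until the list, started from $x$, is first sorted. $\log$ is the natural logarithm. *)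

(* Defs.v *)
From HB Require Import structures.
From mathcomp Require Import all_boot all_order all_algebra all_fingroup.
From mathcomp Require Import all_classical all_reals all_analysis.

Set Implicit Arguments.
Unset Strict Implicit.
Unset Printing Implicit Defensive.

Import Order.TTheory GRing.Theory Num.Theory.

Local Open Scope classical_set_scope.
Local Open Scope ring_scope.

(* An unordered pair {i, j} of distinct positions is represented by the
   ordered pair (i, j) with i < j. *)
Definition position_pair (n : nat) := {e : 'I_n * 'I_n | (e.1 < e.2)%N}.

Definition sort_pair (d : Order.disp_t) (T : orderType d) (n : nat)
    (x : n.-tuple T) (e : position_pair n) : n.-tuple T :=
  let i := (val e).1 in
  let j := (val e).2 in
  if (tnth x i > tnth x j)%O then [tuple tnth x (tperm i j k) | k < n] else x.

(* The list obtained from x after the first t comparisons s 0, ..., s t.-1. *)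
Fixpoint list_after (d : Order.disp_t) (T : orderType d) (n : nat)
    (x : n.-tuple T) (s : nat -> position_pair n) (t : nat) : n.-tuple T :=
  if t is t'.+1 then sort_pair (list_after x s t') (s t') else x.

(* The value is +oo when the list is never sorted. *)
Definition sorting_time (R : realType) (d : Order.disp_t) (T : orderType d)
    (n : nat) (x : n.-tuple T) (s : nat -> position_pair n) : \bar R :=
  ereal_inf [set (t%:R)%:E | t in [set t | sorted <=%O (list_after x s t)]].

(* The subtraction is the truncated one of nat, harmless since e.1 < e.2. *)
Definition harmonic_weight (R : realType) (n : nat) (e : position_pair n) : R :=
  (((val e).2 - (val e).1)%N%:R)^-1.

Definition harmonic_law (R : realType) (n : nat) (e : position_pair n) : R :=
  harmonic_weight R e / \sum_(e' : position_pair n) harmonic_weight R e'.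

Definition mutually_independent (d : measure_display) (Omega : measurableType d)
    (R : realType) (P : probability Omega R) (I : finType)
    (X : nat -> Omega -> I) : Prop :=
  forall (J : seq nat) (A : nat -> set I), uniq J ->
    P (\bigcap_(t in [set` J]) (X t @^-1` A t)) =
    (\prod_(t <- J) P (X t @^-1` A t))%E.

(* X t is the pair compared at step t.+1. *)
Definition harmonic_comparisons (d : measure_display) (Omega : measurableType d)
    (R : realType) (P : probability Omega R) (n : nat)
    (X : nat -> Omega -> position_pair n) : Prop :=
  [/\ forall t (A : set (position_pair n)), measurable (X t @^-1` A),
      forall t (e : position_pair n),
        P (X t @^-1` [set e]) = (harmonic_law R e)%:E
    & mutually_independent P X].

(* Main.v *)
(** The potential [D y = \sum_(i < j) max 0 (r (y i) - r (y j))], with [r] the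
    rank of an entry, vanishes exactly on sorted lists, and the sum of
    [`|r (y i) - r (y j)|] over all pairs is invariant under permutations of [y].
    Hence sorting the pair [i < j] lowers [D] by exactly
    [(j - i) * max 0 (r (y i) - r (y j))]; the harmonic weight cancels the factor
    [j - i], and the mean of [D] is multiplied by exactly [1 - 1 / W] at each step,
    where [W], the total weight, is of order [n * ln n].  As [D <= n ^ 3] at the
    start and [D >= 1] on unsorted lists, Markov's inequality gives the upper bound.

    For the lower bound take the list with a single large entry, at position 0.  If
    that entry is at position [i], sorting multiplies the mean of [(n - i) ^ (-1/2)]
    by at most [1 + 2 / W].  This quantity starts at [n ^ (-1/2)] and is [1] once
    the list is sorted. *)

Require Import Defs.
From HB Require Import structures.
From mathcomp Require Import all_boot all_order all_algebra perm.
From mathcomp Require Import all_classical all_reals all_analysis measurable_realfun.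
From mathcomp Require Import ring lra zify.

Set Implicit Arguments.
Unset Strict Implicit.
Unset Printing Implicit Defensive.

Import Order.TTheory GRing.Theory Num.Theory.

Local Open Scope classical_set_scope.
Local Open Scope ring_scope.

(** * Markov chains driven by independent draws *)

Section chain.
Context (R : realFieldType) (I : finType) (p : I -> R) (S : Type)
  (step : S -> I -> S).

Fixpoint chain_mean (t : nat) (F : S -> R) (y : S) : R :=
  if t is t'.+1 then \sum_e p e * chain_mean t' F (step y e) else F y.

(** The drift argument: with [F] an indicator dominated by [G], this is Markov's inequality for a
    potential whose mean changes by a factor of at most [lambda] per step. It serves with [lambda]
    below 1 (upper bound) and above 1 (lower bound). [Q] is an invariant of the chain. *)
Lemma chain_mean_le (Q : S -> Prop) (lambda : R) (F G : S -> R) :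
  (forall e, 0 <= p e) -> 0 <= lambda ->
  (forall y e, Q y -> Q (step y e)) ->
  (forall y, Q y -> F y <= G y) ->
  (forall y, Q y -> \sum_e p e * G (step y e) <= lambda * G y) ->
  forall t y, Q y -> chain_mean t F y <= lambda ^+ t * G y.
Proof.
move=> p0 l0 Qstep FG contract; elim=> [|t IH] y Qy.
  by rewrite expr0 mul1r FG.
rewrite exprSr -mulrA /=; apply: (@le_trans _ _
  (\sum_e p e * (lambda ^+ t * G (step y e)))).
  by apply: ler_sum => e _; rewrite ler_wpM2l// IH//; exact: Qstep.
under eq_bigr do rewrite mulrCA.
by rewrite -mulr_sumr ler_wpM2l ?exprn_ge0// contract.
Qed.

End chain.

Lemma mkseq_cat (A : Type) (f : nat -> A) m k :
  mkseq f (m + k) = mkseq f m ++ mkseq (fun i => f (m + i)%N) k.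
Proof.
by elim: k => [|k IH]; rewrite ?addn0 ?cats0// addnS !mkseqS IH rcons_cat.
Qed.

Lemma mkseq_eqP (A : eqType) (f : nat -> A) (s : seq A) (a0 : A) :
  mkseq f (size s) = s <-> forall i, (i < size s)%N -> f i = nth a0 s i.
Proof.
split=> [<- i|H]; first by rewrite size_mkseq => ilt; rewrite nth_mkseq.
apply: (@eq_from_nth _ a0); rewrite size_mkseq// => i ilt.
by rewrite nth_mkseq// H.
Qed.

Section iid.
Context (d : measure_display) (Omega : measurableType d) (R : realType)
  (P : probability Omega R) (I : finType) (p : I -> R)
  (X : nat -> Omega -> I).
Context (measX : forall t (A : set I), measurable (X t @^-1` A))
  (lawX : forall t e, P (X t @^-1` [set e]) = (p e)%:E)
  (indepX : mutually_independent P X).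

Local Notation path w m := (mkseq (fun i => X i w) m).

Lemma measurable_path (m : nat) (Q : set (seq I)) :
  measurable [set w | Q (path w m)].
Proof.
elim: m Q => [|m IH] Q.
  have [Q0|nQ0] := pselect (Q [::]).
    by rewrite (_ : [set w | _] = setT)//; apply/seteqP; split.
  by rewrite (_ : [set w | _] = set0)//; apply/seteqP; split.
rewrite (_ : [set w | _] =
  \bigcup_(e in [set: I]) ([set w | Q (rcons (path w m) e)] `&` X m @^-1` [set e])).
  apply: fin_bigcup_measurable => // e _; apply: measurableI => //.
  exact: (IH (fun s => Q (rcons s e))).
apply/seteqP; split=> [w|w [e _ []]] /=; rewrite mkseqS.
  by move=> Qw; exists (X m w).
by move=> + ->.
Qed.

Lemma prob_cylinder (s : seq I) :
  P [set w | path w (size s) = s] = (\prod_(e <- s) p e)%:E.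
Proof.
(* A nonempty [s] supplies the default value that [nth] needs. *)
case E: s => [|e0 s']; last rewrite -E.
  rewrite big_nil (_ : [set w | _] = setT) ?probability_setT//.
  by apply/seteqP; split.
have := indepX (fun i => [set nth e0 s i]) (iota_uniq 0 (size s)).
rewrite (_ : \bigcap_(t in _) _ = [set w | path w (size s) = s]); last first.
  apply/seteqP; split=> w /= => [H|/(mkseq_eqP _ _ e0) H i /=].
    by apply/(mkseq_eqP _ _ e0) => i ilt; apply: H => /=; rewrite mem_iota.
  by rewrite mem_iota; exact: H.
move=> ->; under [LHS]eq_bigr do rewrite lawX.
by rewrite prodEFin [in RHS](big_nth e0) /index_iota subn0.
Qed.

(* Fixing the first [size s] draws makes the induction on [t] go through: one
   more draw splits the event according to its value. *)
Lemma prob_chain_after (S : Type) (step : S -> I -> S) (B : S -> bool) (y : S) t s :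
  P [set w | path w (size s) = s /\ B (foldl step y (path w (size s + t)))] =
  ((\prod_(e <- s) p e) *
    chain_mean p step t (fun z => (B z)%:R) (foldl step y s))%:E.
Proof.
elim: t s => [|t IH] s.
  rewrite addn0 /=; have [Bs|nBs] := boolP (B (foldl step y s)).
    rewrite mulr1 -prob_cylinder; congr (P _).
    by apply/seteqP; split=> w /= => [[]//|E]; rewrite E.
  rewrite mulr0 (_ : [set w | _] = set0) ?measure0//.
  by apply/seteqP; split=> w //= [->]; rewrite (negbTE nBs).
rewrite (_ : [set w | _] = \bigcup_(e in [set` index_enum I])
  [set w | path w (size (rcons s e)) = rcons s e /\
           B (foldl step y (path w (size (rcons s e) + t)))]); last first.
  apply/seteqP; split=> [w /= [E Bw]|w [e _ /=]].
    by exists (X (size s) w); rewrite /= ?mem_index_enum// size_rcons mkseqS E addSnnS.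
  rewrite size_rcons addSnnS mkseqS => -[/rcons_inj[E _] Bw].
  by rewrite {1}E.
rewrite measure_fin_bigcup//; last 2 first.
- move=> e e' _ _ [w /= [[E _] [E' _]]].
  by move: E E'; rewrite !size_rcons => -> /rcons_inj[].
- move=> e _.
  (* The event becomes a condition on one longer path, whose prefix is recovered by [take]. *)
  have -> : [set w | path w (size (rcons s e)) = rcons s e /\
     B (foldl step y (path w (size (rcons s e) + t)))] =
     [set w | [set u | take (size (rcons s e)) u = rcons s e /\
        B (foldl step y u)] (path w (size (rcons s e) + t))].
    by apply/seteqP; split=> w /=; rewrite mkseq_cat take_size_cat ?size_mkseq.
  exact: measurable_path.
rewrite -fsbig_seq ?index_enum_uniq//.
rewrite (eq_bigr _ (fun e _ => IH (rcons s e))).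
rewrite sumEFin /= mulr_sumr; congr (_%:E); apply: eq_bigr => e _.
by rewrite foldl_rcons -cats1 big_cat big_seq1 /= mulrA.
Qed.

Lemma prob_chain (S : Type) (step : S -> I -> S) (B : S -> bool) (y : S) t :
  P [set w | B (foldl step y (path w t))] =
  (chain_mean p step t (fun z => (B z)%:R) y)%:E.
Proof.
have := prob_chain_after step B y t [::]; rewrite big_nil mul1r => <-.
congr (P _); by apply/seteqP; split=> w //= [].
Qed.

End iid.
(** * Sorting times *)

Section sorting.
Context (disp : Order.disp_t) (T : orderType disp) (n : nat).
Implicit Types (x y : n.-tuple T) (e : position_pair n)
  (s : nat -> position_pair n).

Lemma list_afterE x s t : list_after x s t = foldl (@sort_pair _ T n) x (mkseq s t).
Proof. by elim: t => [//|t IH]; rewrite mkseqS foldl_rcons -IH. Qed.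

Lemma sorted_tnthP y :
  reflect (forall i j : 'I_n, (i < j)%N -> (tnth y i <= tnth y j)%O)
          (sorted <=%O y).
Proof.
rewrite sorted_pairwise; last exact: le_trans.
case: n y => [|m] y; first by rewrite (tuple0 y); constructor => -[].
have x0 : T := tnth y ord0.
apply: (iffP (pairwiseP x0)) => [H i j ij|H i j].
  by rewrite !(tnth_nth x0); apply: H; rewrite ?inE ?size_tuple.
rewrite !inE size_tuple => im jm ij.
by have := H (Ordinal im) (Ordinal jm) ij; rewrite !(tnth_nth x0).
Qed.

Lemma sorted_sort_pair y e : sorted <=%O y -> sort_pair y e = y.
Proof. by move=> /sorted_tnthP H; rewrite /sort_pair ltNge H//; exact: valP e. Qed.

Lemma sorted_list_after x s t t' : (t <= t')%N ->
  sorted <=%O (list_after x s t) -> sorted <=%O (list_after x s t').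
Proof.
by move=> + sx; elim: t' => [|t' IH]; rewrite leq_eqVlt => /predU1P[<-//|]//=;
  rewrite ltnS => /IH st'; rewrite sorted_sort_pair.
Qed.

Lemma mem_sort_pair y e v : v \in sort_pair y e -> v \in y.
Proof.
rewrite /sort_pair; case: ifP => // _ /tnthP[k ->].
by rewrite tnth_mktuple mem_tnth.
Qed.

Section time.
Variable R : realType.

(** Sorted lists stay sorted, so the unsorted times form an initial segment and counting them gives
    the sorting time. This turns its mean into a series of tail probabilities. *)
Lemma sorting_timeE x s : sorting_time R x s =
  (\sum_(0 <= t <oo) ((~~ sorted <=%O (list_after x s t))%:R : R)%:E)%E.
Proof.
have ge0 t : (0 <= ((~~ sorted <=%O (list_after x s t))%:R : R)%:E)%E.
  by rewrite lee_fin.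
have [[t0 st0]|unsorted] :=
    pselect (exists t, sorted <=%O (list_after x s t)); last first.
  rewrite /sorting_time (_ : [set _ | _ in _] = set0) ?ereal_inf0; last first.
    by apply/seteqP; split=> // z [t st _]; case: unsorted; exists t.
  (* Never sorted: all terms are 1, so the first [Num.bound A] of them already reach [A]. *)
  apply/esym/eqyP => A A0.
  apply: (le_trans _ (nneseries_lim_ge (Num.bound A) _)) => //.
  rewrite sumEFin lee_fin (eq_bigr (fun=> 1)); last first.
    by move=> t _; case: (boolP (sorted _ _)) => // st; case: unsorted; exists t.
  rewrite sumr_const_nat subn0.
  exact: ltW (archi_boundP (ltW A0)).
have ex : exists t, sorted <=%O (list_after x s t) by exists t0.
case: (ex_minnP ex) => N sN minN {t0 st0 ex}.
rewrite (nneseries_split 0 N)// add0n eseries0 ?adde0; last first.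
  by move=> t Nt _; rewrite (sorted_list_after Nt).
rewrite sumEFin big_mkord (eq_bigr (fun=> 1)); last first.
  move=> t _; case: (boolP (sorted _ _)) => // /minN.
  by rewrite leqNgt ltn_ord.
rewrite sumr_const card_ord; apply/eqP; rewrite eq_le; apply/andP; split.
  by apply: ereal_inf_lbound; exists N.
apply: le_ereal_inf_tmp => _ [t /= /minN Nt <-].
by rewrite lee_fin ler_nat.
Qed.

End time.
End sorting.

(** * The inversion potential *)

Section position_pairs.
Context (R : realFieldType) (n : nat).
Implicit Types f : 'I_n -> R.

Lemma sum_position_pair (F : 'I_n -> 'I_n -> R) :
  \sum_(e : position_pair n) F (val e).1 (val e).2 =
  \sum_(i < n) \sum_(j < n | (i < j)%N) F i j.
Proof.
rewrite pair_big_dep.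
exact/esym/(big_sub (fun e : 'I_n * 'I_n => (e.1 < e.2)%N) (fun e => F e.1 e.2)).
Qed.

Definition inversion_gap f : R :=
  \sum_(e : position_pair n) Num.max 0 (f (val e).1 - f (val e).2).

Let spread f : R := \sum_i \sum_j `|f i - f j|.

Let spread_perm f (s : {perm 'I_n}) : spread (f \o s) = spread f.
Proof.
rewrite /spread [RHS](reindex_inj (@perm_inj _ s)).
by apply: eq_bigr => i _; rewrite [RHS](reindex_inj (@perm_inj _ s)).
Qed.

Let sum_ord_gt (i : 'I_n) : \sum_(j < n | (i < j)%N) (1 : R) = n%:R - 1 - i%:R.
Proof.
rewrite -(big_mkord (fun j => (i < j)%N) (fun=> 1)).
transitivity (\sum_(i.+1 <= j < n) (1 : R)); first by rewrite (big_nat_widenl i.+1 0).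
by rewrite sumr_const_nat natrB// -natr1 opprD addrCA addrC -addrA.
Qed.

Let sum_ord_lt (i : 'I_n) : \sum_(j < n | (j < i)%N) (1 : R) = i%:R.
Proof.
rewrite -(big_mkord (fun j => (j < i)%N) (fun=> 1)).
transitivity (\sum_(0 <= j < i) (1 : R)); last by rewrite sumr_const_nat subn0.
by rewrite (big_nat_widen 0 i n)// ltnW.
Qed.

Lemma exchange_lt (F : 'I_n -> 'I_n -> R) :
  \sum_(i < n) \sum_(j < n | (i < j)%N) F i j =
  \sum_(i < n) \sum_(j < n | (j < i)%N) F j i.
Proof.
under eq_bigr do rewrite big_mkcond.
by rewrite exchange_big; apply: eq_bigr => j _; rewrite -big_mkcond.
Qed.

Let spreadE f :
  spread f = 2 * \sum_(i < n) \sum_(j < n | (i < j)%N) `|f i - f j|.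
Proof.
rewrite mulr2n mulrDl mul1r {2}exchange_lt -big_split; apply: eq_bigr => i _.
rewrite (bigID (fun j : 'I_n => (i < j)%N))/=; congr (_ + _).
rewrite (bigD1 i) ?ltnn//= subrr normr0 add0r.
apply: eq_big => [j|j _]; last exact: distrC.
by rewrite -leqNgt ltn_neqAle andbC.
Qed.

(** Write [max 0 a] as half of [|a| + a]. The absolute values give [spread], which counts each pair
    twice. In the linear part, [f i] appears with sign plus for the [n - 1 - i] later positions and
    minus for the [i] earlier ones. *)
Lemma inversion_gapE f : 4 * inversion_gap f =
  spread f + 2 * \sum_(i < n) (n%:R - 1 - 2 * i%:R) * f i.
Proof.
have maxE (a : R) : Num.max 0 a = 2^-1 * (`|a| + a).
  have [a0|a0] := leP 0 a; first by rewrite ger0_norm//; field.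
  by rewrite ltr0_norm// addNr mulr0.
rewrite /inversion_gap.
rewrite (sum_position_pair (fun i j : 'I_n => Num.max 0 (f i - f j))) spreadE -mulrDr.
rewrite (eq_bigr _ (fun i _ => eq_bigr _ (fun j _ => maxE (f i - f j)))).
under eq_bigr do rewrite -mulr_sumr big_split.
rewrite -mulr_sumr big_split mulrA; congr (_ * (_ + _)).
  by field.
under eq_bigr do rewrite sumrB.
rewrite sumrB [X in _ - X]exchange_lt -sumrB; apply: eq_bigr => i _.
rewrite -[f i]mulr1 -!mulr_sumr sum_ord_gt sum_ord_lt; ring.
Qed.

(** The spread is unchanged, and in the linear part the coefficients of positions [i] and [j] differ
    by [2 * (j - i)]. *)
Lemma inversion_gap_tperm f (i j : 'I_n) : (i < j)%N ->
  inversion_gap (f \o tperm i j) =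
  inversion_gap f - (j - i)%N%:R * (f i - f j).
Proof.
move=> ij; apply: (@mulfI _ 4) => //; rewrite mulrBr !inversion_gapE spread_perm.
have neq : i != j by rewrite neq_ltn ij.
have sumE (g : 'I_n -> R) :
    \sum_k g k = g i + (g j + \sum_(k | (k != i) && (k != j)) g k).
  by rewrite (bigD1 i)//= (bigD1 j)// eq_sym.
rewrite !sumE /= tpermL tpermR.
rewrite (eq_bigr (fun k : 'I_n => (n%:R - 1 - 2 * k%:R) * f k)); last first.
  by move=> k /andP[ki kj]; rewrite tpermD// eq_sym.
by rewrite natrB 1?ltnW//; ring.
Qed.

End position_pairs.

Definition total_weight (R : realType) (n : nat) : R :=
  \sum_(e : position_pair n) harmonic_weight R e.

(** * Mean decrease of the inversion potential *)

Section upper_chain.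
Context (R : realType) (disp : Order.disp_t) (T : orderType disp) (n : nat).
Implicit Types (x y : n.-tuple T).

(** Real values for the entries of an arbitrary total order, taken in the initial list so that they
    stay fixed while the list evolves. Equal entries share a rank. *)
Definition rank x (v : T) : R := (count (fun u => (u < v)%O) x)%:R.

Definition disorder x y : R := inversion_gap (fun i => rank x (tnth y i)).

Lemma rank_homo x : {homo rank x : u v / (u <= v)%O >-> u <= v}.
Proof.
by move=> u v uv; rewrite ler_nat; apply: sub_count => w /= /lt_le_trans; exact.
Qed.

(** Entries below [u] and copies of [u], of which there is at least one, are disjoint families of
    entries below [v]. *)
Lemma rank_strict x u v : u \in x -> (u < v)%O -> rank x u + 1 <= rank x v.
Proof.
move=> ux uv; rewrite natr1 ler_nat -addn1.
apply: (@leq_trans (count (fun w => (w < u)%O) x + count (pred1 u) x)).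
  by rewrite leq_add2l -has_count has_pred1.
rewrite -count_predUI (@eq_count _ (predI _ _) pred0) ?count_pred0 ?addn0.
  by apply: sub_count => w /= /orP[/lt_trans->//|/eqP->].
by move=> w /=; case: eqP => [->|_]; rewrite ?ltxx ?andbF.
Qed.

Lemma rank_le x v : 0 <= rank x v <= n%:R.
Proof. by rewrite ler0n ler_nat -[leqRHS](size_tuple x) count_size. Qed.

Lemma disorder_ge1 x y : {subset y <= x} -> ~~ sorted <=%O y -> 1 <= disorder x y.
Proof.
move=> yx unsorted.
have [[i [j [ij yji]]]|H] := pselect (exists i j : 'I_n,
    (i < j)%N /\ (tnth y j < tnth y i)%O); last first.
  case/negP: unsorted; apply/sorted_tnthP => i j ij.
  by rewrite leNgt; apply/negP => yji; apply: H; exists i, j.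
rewrite /disorder /inversion_gap (bigD1 (Sub (i, j) ij : position_pair n))//=.
apply: ler_wpDr; first by apply: sumr_ge0 => e _; rewrite le_max lexx.
by rewrite le_max lerBrDl rank_strict ?orbT// yx ?mem_tnth.
Qed.

Lemma disorder_le x y : disorder x y <= n%:R ^+ 3.
Proof.
rewrite /disorder /inversion_gap.
rewrite (sum_position_pair (fun i j =>
  Num.max 0 (rank x (tnth y i) - rank x (tnth y j)))).
apply: (@le_trans _ _ (\sum_(i < n) \sum_(j < n) (n%:R : R))); last first.
  by rewrite !sumr_const card_ord -!mulrnA -natrX !expnS expn0 muln1.
apply: ler_sum => i _; rewrite big_mkcond; apply: ler_sum => j _.
case: ifP => // _; rewrite ge_max ler0n/= lerBlDr.
have /andP[_ le_n] := rank_le x (tnth y i).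
by have /andP[ge0 _] := rank_le x (tnth y j); rewrite (le_trans le_n)// lerDl.
Qed.

Lemma disorder_sort_pair x y e : disorder x (sort_pair y e) =
  disorder x y - ((val e).2 - (val e).1)%N%:R *
    Num.max 0 (rank x (tnth y (val e).1) - rank x (tnth y (val e).2)).
Proof.
rewrite /sort_pair; case: ltP => y12.
  rewrite max_r ?subr_ge0 ?rank_homo 1?ltW//.
  rewrite -(inversion_gap_tperm (fun i => rank x (tnth y i)))//; last exact: valP e.
  congr inversion_gap; apply/funext => k /=.
  by rewrite tnth_mktuple.
by rewrite max_l ?mulr0 ?subr0// subr_le0 rank_homo.
Qed.

Lemma disorder_step x y : total_weight R n != 0 ->
  \sum_e harmonic_law R e * disorder x (sort_pair y e) =
  (1 - (total_weight R n)^-1) * disorder x y.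
Proof.
move=> W0.
under eq_bigr do rewrite disorder_sort_pair mulrBr.
rewrite sumrB -mulr_suml -mulr_suml -/(total_weight R n) mulfV//.
rewrite mulrBl !mul1r; congr (_ - _).
rewrite /disorder /inversion_gap mulr_sumr; apply: eq_bigr => e _.
have k0 : ((val e).2 - (val e).1)%N%:R != 0 :> R.
  by rewrite pnatr_eq0 -lt0n subn_gt0; exact: valP e.
by rewrite /harmonic_law /harmonic_weight -/(total_weight R n); field; rewrite W0.
Qed.

End upper_chain.

(** * Size of the total weight *)

Section total_weight.
Context {R : realType}.

Definition harmonic_number (m : nat) : R := \sum_(0 <= k < m) k.+1%:R^-1.

(** Pairs are grouped by their larger position [m]; the distances to it run through 1, ..., [m]. *)
Lemma total_weightE n :
  total_weight R n = \sum_(0 <= m < n) harmonic_number m.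
Proof.
rewrite /total_weight /harmonic_weight
  (sum_position_pair (fun i j : 'I_n => (j - i)%N%:R^-1)).
rewrite exchange_lt big_mkord; apply: eq_bigr => j _.
rewrite -(big_mkord (fun i => (i < j)%N) (fun i => (j - i)%N%:R^-1)).
transitivity (\sum_(0 <= i < j) ((j - i)%N%:R : R)^-1).
  by rewrite (big_nat_widen 0 j n)// ltnW.
rewrite big_nat_rev add0n; apply: eq_big_nat => k /andP[_ kj].
by rewrite subKn.
Qed.

(** This bound and the next are [ln (1 + x) <= x] at [x = 1 / (m + 1)] and [x = - 1 / (m + 2)]. *)
Lemma ln_natS_le m : ln (m.+2%:R : R) - ln m.+1%:R <= m.+1%:R^-1.
Proof.
rewrite -ln_div ?posrE// -[m.+2%:R]natr1 mulrDl mulfV// mul1r.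
by apply: le_ln1Dx; apply: lt_trans (_ : 0 < _); rewrite ?oppr_lt0// invr_gt0.
Qed.

Lemma ln_natS_ge m : m.+2%:R^-1 <= ln (m.+2%:R : R) - ln m.+1%:R.
Proof.
have -> : ln (m.+2%:R : R) - ln m.+1%:R = - ln (1 + - m.+2%:R^-1).
  rewrite -opprB -ln_div ?posrE//; congr (- ln _).
  by rewrite -[m.+2%:R]natr1; field; rewrite nat1r natr1 pnatr_eq0.
by rewrite lerNr le_ln1Dx// ltrN2 invf_lt1// ltr1n.
Qed.

Lemma harmonic_number_ge m : ln (m.+1%:R : R) <= harmonic_number m.
Proof.
elim: m => [|m IH]; first by rewrite ln1 /harmonic_number big_nil.
rewrite /harmonic_number big_nat_recr//= -lerBlDr (le_trans _ IH)//.
by rewrite lerBlDr addrC -lerBlDr ln_natS_le.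
Qed.

Lemma harmonic_number_le m : harmonic_number m.+1 <= 1 + ln (m.+1%:R : R).
Proof.
elim: m => [|m IH].
  by rewrite ln1 /harmonic_number big_nat1 invr1 addr0.
rewrite /harmonic_number big_nat_recr//= -/(harmonic_number m.+1).
apply: le_trans (lerD IH (ln_natS_ge m)) _; lra.
Qed.

Lemma total_weight_le n : (0 < n)%N ->
  total_weight R n <= n%:R * (1 + ln n%:R).
Proof.
move=> n0; rewrite total_weightE.
apply: (@le_trans _ _ (\sum_(0 <= m < n) (1 + ln (n%:R : R)))); last first.
  by rewrite sumr_const_nat subn0 mulr_natl.
rewrite !big_nat; apply: ler_sum => -[_|m /andP[_ mn]].
  by rewrite /harmonic_number big_nil addr_ge0// ln_ge0// ler1n.
apply: le_trans (harmonic_number_le m) _.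
by rewrite lerD2l ler_ln ?posrE ?ltr0n// ler_nat ltnW.
Qed.

Lemma total_weight_ge n : n%:R * ln n%:R - n%:R <= total_weight R n.
Proof.
rewrite total_weightE; elim: n => [|n IH].
  by rewrite mul0r subrr big_nil.
rewrite big_nat_recr//=; have := harmonic_number_ge n.
(* This amounts to [n * (ln (n + 1) - ln n) <= 1]. *)
suff : n.+1%:R * ln n.+1%:R - n.+1%:R <= n%:R * ln n%:R - n%:R + ln (n.+1%:R : R).
  by move: IH; lra.
case: n {IH} => [|n]; first by rewrite ln1 !mulr0 mul0r; lra.
have := ln_natS_le n; rewrite -(ler_pM2l (ltr0Sn R n)) mulfV//.
by rewrite -[n.+2%:R]natr1 /=; lra.
Qed.

(** Makes the contraction factor [1 - 1 / W] nonnegative. *)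
Lemma total_weight_ge1 n : (2 <= n)%N -> 1 <= total_weight R n.
Proof.
case: n => [|[|n]]// _; rewrite total_weightE big_ltn// big_ltn//.
rewrite /harmonic_number big_nil big_nat1 invr1 add0r lerDl.
by apply: sumr_ge0 => i _; apply: sumr_ge0 => k _.
Qed.

End total_weight.

(** * Moves of a single large entry *)

Section lower_chain.
Context {R : realType} {n : nat}.
Implicit Types (i : 'I_n) (e : position_pair n).

(** As [false < true], the only [true] is the large entry. *)
Definition single_one (i : 'I_n) : n.-tuple bool := [tuple k == i | k < n].

(** A pair whose larger position is [i] is already in order, so only the smaller position
    matters. *)
Definition hop (i : 'I_n) (e : position_pair n) : 'I_n :=
  if (val e).1 == i then (val e).2 else i.

Lemma sort_pair_single_one i e :
  sort_pair (single_one i) e = single_one (hop i e).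
Proof.
case: e => -[a b] /= ab; rewrite /sort_pair /hop /= !tnth_mktuple.
have ba : b != a by rewrite neq_ltn ab orbT.
case: (eqVneq a i) => [<-|ai]; last by case: (b == i).
rewrite (negbTE ba) /=; apply: eq_from_tnth => k.
rewrite !tnth_mktuple -(inj_eq (@perm_inj _ (tperm a b)) k b) tpermR.
by [].
Qed.

Lemma foldl_single_one i (s : seq (position_pair n)) :
  foldl (@sort_pair _ bool n) (single_one i) s = single_one (foldl hop i s).
Proof. by elim: s i => //= e s IH i; rewrite sort_pair_single_one IH. Qed.

Lemma sorted_single_one i : sorted <=%O (single_one i) -> (i.+1 = n)%N.
Proof.
move=> /sorted_tnthP H; apply/eqP; rewrite eqn_leq ltn_ord /= leqNgt.
apply/negP => lt_in; have := H i (Ordinal lt_in) (ltnSn _).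
by rewrite !tnth_mktuple eqxx -val_eqE /= gtn_eqF.
Qed.

(** Distances are taken to [n] rather than to [n - 1]: they stay positive, and the value at the last
    position is 1. *)
Definition inv_sqrt_dist (i : 'I_n) : R := (Num.sqrt (n - i)%N%:R)^-1.

Lemma sum_inv_sqrt_le m :
  \sum_(0 <= k < m) (Num.sqrt (k.+1%:R : R))^-1 <= 2 * Num.sqrt m%:R.
Proof.
elim: m => [|m IH]; first by rewrite big_nil mulr_ge0// sqrtr_ge0.
rewrite big_nat_recr//=; apply: le_trans (lerD IH (lexx _)) _.
have s0 : 0 < Num.sqrt (m.+1%:R : R) by rewrite sqrtr_gt0.
have ab : Num.sqrt (m%:R : R) <= Num.sqrt m.+1%:R by rewrite ler_sqrt// ler_nat.
have sqr_b : Num.sqrt (m.+1%:R : R) ^+ 2 = Num.sqrt m%:R ^+ 2 + 1.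
  by rewrite !sqr_sqrtr// natr1.
move: s0 ab sqr_b (sqrtr_ge0 (m%:R : R)).
move: (Num.sqrt m.+1%:R) (Num.sqrt m%:R) => b a b0 ab sqr_b a0.
(* From [b ^ 2 - a ^ 2 = 1], [b - a] is [1 / (a + b)], at least [1 / (2 * b)]. *)
suff : b^-1 <= 2 * (b - a) by lra.
by rewrite -[b^-1]mul1r ler_pdivrMr//; nra.
Qed.

(** With [a] and [b] the roots of [n - j] and [n - i], the factor [b - a] cancels and the left side
    is [1 / (a * b * (a + b))], at most [1 / (a * b ^ 2)]. *)
Lemma inv_sqrt_dist_jump (i j : 'I_n) : (i < j)%N ->
  (j - i)%N%:R^-1 * (inv_sqrt_dist j - inv_sqrt_dist i) <=
  (n - i)%N%:R^-1 * (Num.sqrt (n - j)%N%:R)^-1.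
Proof.
move=> ij; rewrite /inv_sqrt_dist.
have nj0 : (0 < n - j)%N by rewrite subn_gt0.
have ni0 : (0 < n - i)%N by rewrite subn_gt0.
have -> : (j - i = (n - i) - (n - j))%N by have := ltn_ord j; lia.
have mk : (n - j < n - i)%N by have := ltn_ord j; lia.
move: (n - i)%N (n - j)%N ni0 nj0 mk => m k m0 k0 km {i j ij}.
rewrite natrB 1?ltnW//.
set a := Num.sqrt (k%:R : R); set b := Num.sqrt (m%:R : R).
have a0 : 0 < a by rewrite sqrtr_gt0 ltr0n.
have ab : a < b by rewrite ltr_sqrt ?ltr_nat// ltr0n.
have -> : k%:R = a ^+ 2 by rewrite sqr_sqrtr.
have -> : m%:R = b ^+ 2 by rewrite sqr_sqrtr.
have -> : (b ^+ 2 - a ^+ 2)^-1 * (a^-1 - b^-1) = (a * b * (a + b))^-1.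
  have ? : b ^+ 2 - a ^+ 2 != 0 by rewrite subr_sqr mulf_neq0 //; lra.
  field; apply/and4P; split => //; lra.
have b0 : 0 < b by exact: lt_trans ab.
rewrite -invfM lef_pV2 ?posrE ?mulr_gt0 ?exprn_gt0 ?addr_gt0//.
by rewrite mulrDr expr2 mulrAC (mulrC b a) -mulrA lerDr !mulr_ge0// ltW.
Qed.

(* With [m = n - i] the jump bounds sum to [m^-1 * \sum_(k < m) k ^ (-1/2)],
   at most [2 * m ^ (-1/2)]. *)
Lemma sum_jumps_le i :
  \sum_(j < n | (i < j)%N) (j - i)%N%:R^-1 * (inv_sqrt_dist j - inv_sqrt_dist i)
  <= 2 * inv_sqrt_dist i.
Proof.
have ni0 : 0 < (n - i)%N%:R :> R by rewrite ltr0n subn_gt0.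
apply: le_trans (ler_sum _ (fun j ij => inv_sqrt_dist_jump ij)) _.
rewrite -mulr_sumr.
rewrite -(big_mkord (fun j => (i < j)%N) (fun j => (Num.sqrt ((n - j)%N%:R : R))^-1)).
rewrite (_ : \sum_(0 <= j < n | _) _ =
    \sum_(0 <= k < (n - i).-1) (Num.sqrt (k.+1%:R : R))^-1); last first.
  transitivity (\sum_(i.+1 <= j < n) (Num.sqrt ((n - j)%N%:R : R))^-1).
    by rewrite (big_nat_widenl i.+1 0).
  rewrite big_nat_rev -{1}[i.+1]add0n big_addn (_ : n - i.+1 = (n - i).-1)%N; last lia.
  by apply: eq_big_nat => k kn; congr (Num.sqrt _%:R)^-1; lia.
have : \sum_(0 <= k < (n - i).-1) (Num.sqrt (k.+1%:R : R))^-1 <= 2 * Num.sqrt (n - i)%N%:R.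
  apply: le_trans (sum_inv_sqrt_le _) _.
  by rewrite ler_pM2l// ler_sqrt// ler_nat leq_pred.
rewrite -(ler_pM2l (_ : 0 < (n - i)%N%:R^-1)) ?invr_gt0// => /le_trans; apply.
rewrite mulrCA ler_pM2l// /inv_sqrt_dist.
rewrite -[X in X^-1 * _ <= _](sqr_sqrtr (ltW ni0)) expr2 invfM -mulrA mulVf ?mulr1//.
by rewrite gt_eqF// sqrtr_gt0.
Qed.

Lemma inv_sqrt_dist_step i : total_weight R n != 0 ->
  \sum_e harmonic_law R e * inv_sqrt_dist (hop i e) <=
  (1 + 2 / total_weight R n) * inv_sqrt_dist i.
Proof.
move=> W0.
have W_gt0 : 0 < total_weight R n.
  by rewrite lt_def W0; apply: sumr_ge0 => e _; rewrite invr_ge0.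
have -> : \sum_e harmonic_law R e * inv_sqrt_dist (hop i e) = inv_sqrt_dist i +
    (total_weight R n)^-1 *
    \sum_(j < n | (i < j)%N) (j - i)%N%:R^-1 * (inv_sqrt_dist j - inv_sqrt_dist i).
  (* The mean is split into the current value and the change, which comes only from pairs with
     smaller position [i]. *)
  transitivity (\sum_(e : position_pair n) harmonic_law R e * inv_sqrt_dist i +
     \sum_(e : position_pair n) (total_weight R n)^-1 *
      (if (val e).1 == i then ((val e).2 - (val e).1)%N%:R^-1 *
        (inv_sqrt_dist (val e).2 - inv_sqrt_dist i) else 0)).
    rewrite -big_split; apply: eq_bigr => e _ /=.
    rewrite /hop /harmonic_law /harmonic_weight -/(total_weight R n).
    by case: eqP => [->|_]; ring.
  rewrite -mulr_suml -mulr_suml -/(total_weight R n) mulfV// mul1r; congr (_ + _).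
  rewrite -mulr_sumr; congr (_ * _).
  rewrite (sum_position_pair (fun a b : 'I_n => if a == i then
    (b - a)%N%:R^-1 * (inv_sqrt_dist b - inv_sqrt_dist i) else 0)).
  rewrite (bigD1 i)//= [X in _ + X]big1 ?addr0.
    by apply: eq_bigr => j _; rewrite eqxx.
  by move=> a /negbTE ai; rewrite big1// => b _; rewrite ai.
rewrite mulrDl mul1r lerD2l mulrAC mulrC ler_pM2r ?invr_gt0//.
exact: sum_jumps_le.
Qed.

End lower_chain.

(** * Tails and mean of the sorting time *)

Section sorting_events.
Context (d : measure_display) (Omega : measurableType d) (R : realType)
  (P : probability Omega R) (n : nat) (X : nat -> Omega -> position_pair n).
Context (comparisonsX : harmonic_comparisons P X).
Context (disp : Order.disp_t) (T : orderType disp) (x : n.-tuple T).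

Definition unsorted_at (t : nat) : set Omega :=
  [set w | ~~ sorted <=%O (list_after x (X^~ w) t)].

Lemma measurable_unsorted_at t : measurable (unsorted_at t).
Proof.
have [measX _ _] := comparisonsX.
rewrite /unsorted_at; under eq_set do rewrite list_afterE.
exact: (measurable_path measX t (fun s => ~~ sorted <=%O (foldl (@sort_pair _ T n) x s))).
Qed.

Lemma prob_unsorted_at t : P (unsorted_at t) =
  (chain_mean (harmonic_law R (n:=n)) (@sort_pair _ T n) t
     (fun y => (~~ sorted <=%O y)%:R) x)%:E.
Proof.
have [measX lawX indepX] := comparisonsX.
rewrite /unsorted_at; under eq_set do rewrite list_afterE.
exact: (prob_chain measX lawX indepX _ (fun y : n.-tuple T => ~~ sorted <=%O y)).
Qed.

Lemma prob_unsorted_at_nonincreasing t t' : (t <= t')%N ->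
  (P (unsorted_at t') <= P (unsorted_at t))%E.
Proof.
move=> tt'; apply: le_measure; rewrite ?inE; [exact: measurable_unsorted_at..|].
by move=> w; apply: contraNN; exact: sorted_list_after.
Qed.

Lemma expected_sorting_time :
  (\int[P]_w sorting_time R x (X^~ w) =
   \sum_(0 <= t <oo) P (unsorted_at t))%E.
Proof.
under eq_integral do rewrite sorting_timeE.
rewrite integral_nneseries//; last first.
  move=> t; apply/measurable_EFinP.
  rewrite (_ : (fun _ => _) = \1_(unsorted_at t)).
    exact/measurable_indic/measurable_unsorted_at.
  by apply/funext => w; rewrite indicE mem_setE.
apply: eq_eseriesr => t _.
rewrite -[unsorted_at t in RHS]setIT.
rewrite -(integral_indic P measurableT (measurable_unsorted_at t)).
by apply: eq_integral => w _; rewrite indicE mem_setE.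
Qed.

(** Sorting times are natural numbers or infinite, so exceeding [r] means exceeding its integer
    part. *)
Lemma sorting_time_gt (r : R) : 0 <= r ->
  [set w | (r%:E < sorting_time R x (X^~ w))%E] = unsorted_at (Num.truncn r).
Proof.
move=> r0; have /andP[le_r lt_r] := truncn_itv r0.
apply/seteqP; split=> w /=; rewrite /unsorted_at /=.
  apply: contraTN => sorted_N; rewrite -leNgt.
  apply: (@le_trans _ _ ((Num.truncn r)%:R)%:E); last by rewrite lee_fin.
  by apply: ereal_inf_lbound; exists (Num.truncn r).
move=> unsorted; apply: (@lt_le_trans _ _ ((Num.truncn r).+1%:R)%:E).
  by rewrite lte_fin.
apply: le_ereal_inf_tmp => _ [t sorted_t <-]; rewrite lee_fin ler_nat ltnNge.
by apply: contraNN unsorted => /sorted_list_after; apply.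
Qed.

(** Only an inequality: for an integer [r], the right side also includes sorting at time exactly
    [r]. *)
Lemma prob_sorting_time_lt (r : R) : 0 <= r ->
  (P [set w | (sorting_time R x (X^~ w) < r%:E)%E] <=
   P (~` unsorted_at (Num.truncn r)))%E.
Proof.
move=> r0; apply: le_measure; rewrite ?inE.
- rewrite (_ : [set w | _] = \bigcup_(t in [set t | t%:R < r]) ~` unsorted_at t).
    by apply: bigcup_measurable => t _; exact/measurableC/measurable_unsorted_at.
  apply/seteqP; split=> w /=.
    move=> /ereal_inf_lt[_ [t sorted_t <-]]; rewrite lte_fin => tr.
    by exists t => //=; apply/negP; rewrite negbK.
  move=> [t /= tr /negP]; rewrite negbK => sorted_t.
  apply: (@le_lt_trans _ _ (t%:R)%:E); last by rewrite lte_fin.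
  by apply: ereal_inf_lbound; exists t.
- exact/measurableC/measurable_unsorted_at.
move=> w /= /ereal_inf_lt[_ [t sorted_t <-]]; rewrite lte_fin => tr.
apply/negP; rewrite negbK; apply: sorted_list_after sorted_t.
by rewrite truncn_ge_nat// ltW.
Qed.

Lemma prob_unsorted_at_le t : (2 <= n)%N ->
  (P (unsorted_at t) <=
   (n%:R ^+ 3 * (1 - (total_weight R n)^-1) ^+ t)%:E)%E.
Proof.
move=> n2; have W1 := @total_weight_ge1 R n n2.
have W0 : 0 < total_weight R n by apply: lt_le_trans W1.
rewrite prob_unsorted_at lee_fin [leRHS]mulrC.
have q0 : 0 <= 1 - (total_weight R n)^-1.
  by rewrite subr_ge0 invf_le1.
apply: le_trans (ler_wpM2l (exprn_ge0 t q0) (disorder_le R x x)).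
(* [disorder_ge1] needs all entries of the current list to occur in [x]. *)
apply: (chain_mean_le (Q := fun y => {subset y <= x})) => //.
- move=> e; rewrite mulr_ge0 ?invr_ge0//.
  by apply: sumr_ge0 => e' _; rewrite invr_ge0.
- by move=> y e yx v /mem_sort_pair /yx.
- move=> y yx; case: (boolP (sorted _ _)) => [_|unsorted].
    by apply: sumr_ge0 => e _; rewrite le_max lexx.
  exact: disorder_ge1.
- by move=> y _; rewrite disorder_step// gt_eqF.
Qed.

End sorting_events.

Lemma prob_single_one_sorted_le (d : measure_display) (Omega : measurableType d)
    (R : realType) (P : probability Omega R) (n : nat)
    (X : nat -> Omega -> position_pair n) (i : 'I_n) (t : nat) :
  (2 <= n)%N -> harmonic_comparisons P X ->
  (P (~` unsorted_at X (single_one i) t) <=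
   ((1 + 2 / total_weight R n) ^+ t * inv_sqrt_dist i)%:E)%E.
Proof.
move=> n2 [measX lawX indepX]; have W1 := @total_weight_ge1 R n n2.
have W0 : 0 < total_weight R n by apply: lt_le_trans W1.
have -> : ~` unsorted_at X (single_one i) t =
    [set w | sorted <=%O (single_one (foldl hop i (mkseq (X^~ w) t)))].
  apply/seteqP; split=> w /=; rewrite /unsorted_at /= list_afterE foldl_single_one.
    by move=> /negP; rewrite negbK.
  by move=> st; apply/negP; rewrite negbK.
(* The chain is followed on positions of the large entry instead of lists. *)
rewrite (prob_chain measX lawX indepX _ (fun j => sorted <=%O (single_one j))).
rewrite lee_fin; apply: (chain_mean_le (Q := fun=> True)) => //.
- move=> e; rewrite mulr_ge0 ?invr_ge0//.
  by apply: sumr_ge0 => e' _; rewrite invr_ge0.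
- by rewrite addr_ge0// divr_ge0// ltW.
- move=> j _; case: (boolP (sorted _ _)) => [/sorted_single_one jn|_].
    by rewrite /inv_sqrt_dist -[in X in (X - _)%N]jn subSnn sqrtr1 invr1.
  by rewrite invr_ge0 sqrtr_ge0.
- by move=> j _; apply: inv_sqrt_dist_step; rewrite gt_eqF.
Qed.

(** The first [N] terms are bounded by 1, the others by a geometric series of sum [q ^ N * W]. *)
Lemma sum_le_geometric_tail (R : realFieldType) (a : nat -> R) (A q W : R) (N K : nat) :
  0 <= A -> 0 <= q -> 0 <= W -> (1 - q) * W = 1 ->
  (forall t, 0 <= a t <= 1) -> (forall t, a t <= A * q ^+ t) ->
  \sum_(0 <= t < K) a t <= N%:R + A * q ^+ N * W.
Proof.
move=> A0 q0 W0 qW a01 aq.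
have geom : \sum_(N <= t < N + K) q ^+ t = q ^+ N * W - q ^+ (N + K) * W.
  elim: K => [|K IH]; first by rewrite addn0 big_geq// subrr.
  rewrite addnS big_nat_recr ?leq_addr//= IH exprS -[X in _ + X]mulr1 -qW; ring.
(* Enlarging the range allows a split at [N] whether or not [K] exceeds [N]. *)
apply: (@le_trans _ _ (\sum_(0 <= t < N + K) a t)).
  rewrite [leRHS](big_cat_nat (n := K)) ?leq_addl//= lerDl.
  by apply: sumr_ge0 => t _; have /andP[] := a01 t.
rewrite (big_cat_nat (n := N)) ?leq_addr//= lerD//.
  apply: (@le_trans _ _ (\sum_(0 <= t < N) 1)).
    by apply: ler_sum => t _; have /andP[] := a01 t.
  by rewrite sumr_const_nat subn0.
apply: le_trans (ler_sum _ (fun t _ => aq t)) _.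
rewrite -mulr_sumr geom -mulrA ler_wpM2l// gerBl.
by rewrite mulr_ge0// exprn_ge0.
Qed.

(** * Numerical estimates *)

Section estimates.
Context {R : realType}.

Lemma ln_ge_half n : (2 <= n)%N -> 2^-1 <= ln (n%:R : R).
Proof.
move=> n2; apply: (@le_trans _ _ (ln 2)); last first.
  by rewrite ler_ln ?posrE ?ltr0n ?ler_nat// ltnW.
have : ln (1 + - 2^-1 : R) <= - 2^-1 by apply: le_ln1Dx; lra.
rewrite (_ : 1 + - 2^-1 = 2^-1 :> R); last by lra.
by rewrite lnV ?posrE// lerN2.
Qed.

Lemma total_weight_le3 n : (2 <= n)%N ->
  total_weight R n <= 3 * (n%:R * ln n%:R).
Proof.
move=> n2; apply: le_trans (total_weight_le (ltnW n2)) _.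
have n0 : 0 <= n%:R :> R by [].
have L0 := ln_ge_half n2; move: n0 L0; move: (n%:R : R) (ln (n%:R : R)) => m L; nra.
Qed.

(** Here [(1 - 1 / W) ^ N] is at most [exp (- N / W)], and [W <= 3 * n * ln n] gives
    [N / W >= 4 * ln n]: three powers of [n] offset [n ^ 3] and one remains. *)
Lemma unsorted_bound n N : (2 <= n)%N -> 12 * n%:R * ln n%:R ^+ 2 <= N%:R :> R ->
  n%:R ^+ 3 * (1 - (total_weight R n)^-1) ^+ N <= (n%:R)^-1.
Proof.
move=> n2 leN; have W1 := @total_weight_ge1 R n n2.
have W0 : 0 < total_weight R n by apply: lt_le_trans W1.
have n0 : 0 < n%:R :> R by rewrite ltr0n ltnW.
have L0 := ln_ge_half n2.
rewrite -[X in X ^+ 3]lnK ?posrE// -[X in _ <= X^-1]lnK ?posrE//.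
rewrite -expRM_natl -expRN.
apply: (@le_trans _ _ (expR (3 * ln n%:R) * expR (N%:R * - (total_weight R n)^-1))).
  rewrite ler_pM2l ?expR_gt0// expRM_natl lerXn2r ?nnegrE ?expR_ge0 ?expR_ge1Dx//.
  by rewrite subr_ge0 invf_le1.
rewrite -expRD ler_expR mulrN.
suff : 4 * ln n%:R <= N%:R / total_weight R n.
  by move: (N%:R / _) (ln (n%:R : R)) => z L; lra.
rewrite ler_pdivlMr//; have := total_weight_le3 n2.
move: leN L0 n0 W0.
move: (N%:R : R) (n%:R : R) (total_weight R n) (ln (n%:R : R)) => M m W L.
move=> leN L0 m0 W0 leW; apply: le_trans leN.
rewrite (_ : 12 * m * L ^+ 2 = 4 * L * (3 * (m * L))); last by ring.
by rewrite ler_wpM2l//; lra.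
Qed.

(** For [ln n >= 2], [W] is at least half of [n * ln n], so the growth factor [exp (2 * N / W)] is
    at most [n ^ (1/4)]; it uses up half of the exponent in [n ^ (-1/2)]. *)
Lemma sorted_bound n N : (2 <= n)%N -> 2 <= ln n%:R :> R ->
  N%:R <= 16^-1 * n%:R * ln n%:R ^+ 2 :> R ->
  (1 + 2 / total_weight R n) ^+ N * (Num.sqrt n%:R)^-1 <= expR (- 4^-1 * ln n%:R).
Proof.
move=> n2 L2 leN; have W1 := @total_weight_ge1 R n n2.
have W0 : 0 < total_weight R n by apply: lt_le_trans W1.
have n0 : 0 < n%:R :> R by rewrite ltr0n ltnW.
have -> : (Num.sqrt n%:R)^-1 = expR (- 2^-1 * ln (n%:R : R)).
  by rewrite -powR12_sqrt ?ltW// /powR gt_eqF// mulNr expRN.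
apply: (@le_trans _ _ (expR (N%:R * (2 / total_weight R n)) * expR (- 2^-1 * ln n%:R))).
  rewrite ler_pM2r ?expR_gt0// expRM_natl lerXn2r ?nnegrE ?expR_ge0 ?expR_ge1Dx//.
  by rewrite addr_ge0// divr_ge0// ltW.
rewrite -expRD ler_expR.
suff : N%:R * (2 / total_weight R n) <= 4^-1 * ln n%:R by lra.
rewrite mulrA ler_pdivrMr//; have := @total_weight_ge R n.
move: leN L2 n0 W0.
move: (N%:R : R) (n%:R : R) (total_weight R n) (ln (n%:R : R)) => M m W L.
move=> leN L2 m0 W0 leW.
have : 2^-1 * m * L <= W by nra.
move=> leW2; apply: (@le_trans _ _ (4^-1 * L * (2^-1 * m * L))).
  rewrite (_ : 4^-1 * L * _ = 16^-1 * m * L ^+ 2 * 2); last by field.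
  by rewrite ler_pM2r.
by rewrite ler_wpM2l//; lra.
Qed.

Lemma expR_half_bounds : 2^-1 <= expR (- 2^-1 : R) <= 2 / 3.
Proof.
apply/andP; split; first by have := expR_ge1Dx (- 2^-1 : R); lra.
rewrite expRN; have := expR_ge1Dx (2^-1 : R) => e1.
rewrite -[X in _ <= X]invrK lef_pV2 ?posrE ?expR_gt0 ?invr_gt0//; lra.
Qed.

End estimates.

(** Lets the constants absorb the loss from truncating a real number of steps. *)
Lemma nln2_ge_half (R : realType) n : (2 <= n)%N ->
  2^-1 <= n%:R * ln n%:R ^+ 2 :> R.
Proof.
move=> n2; have n2R : 2 <= n%:R :> R by rewrite ler_nat.
have := ln_ge_half (R := R) n2; move: n2R.
move: (n%:R : R) (ln (n%:R : R)) => m L m2 L2.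
have : 4^-1 <= L ^+ 2 by rewrite expr2; nra.
by move: (L ^+ 2) => z z4; nra.
Qed.

(** * Upper bounds for an arbitrary list *)

Section upper_bounds.
Context (d : measure_display) (Omega : measurableType d) (R : realType)
  (P : probability Omega R) (n : nat) (X : nat -> Omega -> position_pair n).
Context (n2 : (2 <= n)%N) (comparisonsX : harmonic_comparisons P X).
Context (disp : Order.disp_t) (T : orderType disp) (x : n.-tuple T).

Local Notation L := (ln (n%:R : R)).

Lemma prob_sorting_time_gt_le :
  (P [set w | ((30 * n%:R * L ^+ 2)%:E < sorting_time R x (X^~ w))%E]
     <= (n%:R^-1)%:E)%E.
Proof.
have nL := nln2_ge_half R n2.
have r0 : 0 <= 30 * n%:R * L ^+ 2 by rewrite -mulrA; lra.
rewrite sorting_time_gt//; apply: le_trans (prob_unsorted_at_le comparisonsX x _ n2) _.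
rewrite lee_fin unsorted_bound//.
have /andP[_] := truncn_itv r0; rewrite -natr1.
by move: nL; rewrite -!mulrA; move: (n%:R * L ^+ 2) => z; lra.
Qed.

(** The first [24 * n * L ^ 2] terms are bounded by 1; the tail is at most
    [W / n <= 3 * L <= 6 * n * L ^ 2]. Together they give the constant 30. *)
Lemma expected_sorting_time_le :
  (\int[P]_w sorting_time R x (X^~ w) <= (30 * n%:R * L ^+ 2)%:E)%E.
Proof.
rewrite expected_sorting_time//; apply: lime_le.
  by apply: is_cvg_nneseries => t _ _; exact: measure_ge0.
near=> K; have nL := nln2_ge_half R n2.
have L_ge := ln_ge_half (R := R) n2.
have n_gt0 : 0 < n%:R :> R by rewrite ltr0n ltnW.
have r0 : 0 <= 24 * n%:R * L ^+ 2 by rewrite -mulrA; lra.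
set N := Num.truncn (24 * n%:R * L ^+ 2).
have PE t := prob_unsorted_at comparisonsX x t.
rewrite (eq_bigr _ (fun t _ => PE t)) sumEFin lee_fin.
have W1 := @total_weight_ge1 R n n2.
have W0 : 0 < total_weight R n by apply: lt_le_trans W1.
have /andP[N_le lt_N] := truncn_itv r0.
apply: le_trans (@sum_le_geometric_tail _ _ (n%:R ^+ 3)
  (1 - (total_weight R n)^-1) (total_weight R n) N K _ _ _ _ _ _) _.
- exact: exprn_ge0.
- by rewrite subr_ge0 invf_le1.
- exact: ltW.
- by rewrite subKr mulVf// gt_eqF.
- move=> t; rewrite -!lee_fin -PE measure_ge0 probability_le1//.
  exact: (measurable_unsorted_at comparisonsX).
- by move=> t; rewrite -lee_fin -PE; exact: prob_unsorted_at_le.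
have NP : 12 * n%:R * L ^+ 2 <= N%:R.
  move: lt_N nL; rewrite -/N -[N.+1%:R]natr1 -!mulrA.
  by move: (n%:R * L ^+ 2) (N%:R : R) => z M; lra.
apply: (@le_trans _ _ (24 * n%:R * L ^+ 2 + n%:R^-1 * (3 * (n%:R * L)))).
  apply: lerD => //; apply: ler_pM.
  - by rewrite mulr_ge0 ?exprn_ge0// subr_ge0 invf_le1.
  - exact: ltW.
  - exact: unsorted_bound.
  - exact: total_weight_le3.
have -> : n%:R^-1 * (3 * (n%:R * L)) = 3 * L by field; rewrite gt_eqF.
have : L <= 2 * (n%:R * L ^+ 2).
  have n_ge2 : 2 <= n%:R :> R by rewrite ler_nat.
  rewrite expr2; move: n_ge2 L_ge; move: (n%:R : R) (ln (n%:R : R)) => m l m2 l2.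
  have : 1 <= m * l by nra.
  by nra.
by rewrite -!mulrA; move: (n%:R * L ^+ 2) => z; lra.
Unshelve. all: by end_near.
Qed.
End upper_bounds.

(** * Lower bounds for a single large entry *)

Section lower_bounds.
Context (d : measure_display) (Omega : measurableType d) (R : realType)
  (P : probability Omega R) (n : nat) (X : nat -> Omega -> position_pair n).
Context (n2 : (2 <= n)%N) (comparisonsX : harmonic_comparisons P X).

Local Notation L := (ln (n%:R : R)).

Let origin : 'I_n := Ordinal (ltnW n2).
Let x := single_one origin.

Lemma prob_single_one_sorted_le_expR N : 2 <= L ->
  N%:R <= 16^-1 * n%:R * L ^+ 2 :> R ->
  (P (~` unsorted_at X x N) <= (expR (- 4^-1 * L))%:E)%E.
Proof.
move=> L2 leN; apply: le_trans (prob_single_one_sorted_le origin N n2 comparisonsX) _.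
by rewrite lee_fin /inv_sqrt_dist subn0 sorted_bound.
Qed.

Lemma prob_sorting_time_lt_le :
  (P [set w | (sorting_time R x (X^~ w) < (64^-1 * n%:R * L ^+ 2)%:E)%E]
     <= (30 * expR (- 4^-1 * L))%:E)%E.
Proof.
have nL := nln2_ge_half R n2.
have r0 : 0 <= 64^-1 * n%:R * L ^+ 2 by rewrite -mulrA; lra.
apply: le_trans (prob_sorting_time_lt comparisonsX x r0) _.
have [L2|L2] := leP 2 L.
  apply: le_trans (prob_single_one_sorted_le_expR L2 _) _.
    have /andP[le_r _] := truncn_itv r0; apply: le_trans le_r _.
    by rewrite -!mulrA ler_wpM2r//; lra.
  by rewrite lee_fin; have := expR_ge0 (- 4^-1 * L); lra.
(* For [L < 2] the claimed bound exceeds 1, since [exp (- L / 4) > 1/2]. *)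
apply: le_trans (probability_le1 _ _) _.
  exact/measurableC/(measurable_unsorted_at comparisonsX).
by rewrite lee_fin; have := expR_ge1Dx (- 4^-1 * L); lra.
Qed.

Lemma expected_sorting_time_ge :
  ((64^-1 * n%:R * L ^+ 2)%:E <= \int[P]_w sorting_time R x (X^~ w))%E.
Proof.
have nL := nln2_ge_half R n2.
have n_gt0 : 0 < n%:R :> R by rewrite ltr0n ltnW.
rewrite expected_sorting_time//.
have U0 t : (0 <= P (unsorted_at X x t))%E by exact: measure_ge0.
have [L2|L2] := leP 2 L.
  have r0 : 0 <= 16^-1 * n%:R * L ^+ 2 by rewrite -mulrA; lra.
  have /andP[N_le lt_N] := truncn_itv r0.
  set N := Num.truncn (16^-1 * n%:R * L ^+ 2) in N_le lt_N.
  apply: le_trans (nneseries_lim_ge N.+1 _) => //.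
  (* By monotonicity each of the first [N + 1] terms is then at least 1/3, for a total of at least
     [n * L ^ 2 / 48]. *)
  have UN : ((1 / 3)%:E <= P (unsorted_at X x N))%E.
    have := prob_single_one_sorted_le_expR L2 N_le.
    rewrite probability_setC; last exact: (measurable_unsorted_at comparisonsX).
    rewrite prob_unsorted_at// -EFinB !lee_fin.
    have : expR (- 4^-1 * L) <= 2 / 3.
      apply: le_trans (_ : expR (- 2^-1) <= _); last first.
        by case/andP: (@expR_half_bounds R).
      by rewrite ler_expR; lra.
    by lra.
  apply: (@le_trans _ _ (\sum_(0 <= t < N.+1) (1 / 3 : R)%:E)%E).
    rewrite sumEFin lee_fin sumr_const_nat subn0 -[_ *+ N.+1]mulr_natr.
    move: lt_N nL; rewrite -!mulrA.
    by move: (n%:R * L ^+ 2) (N.+1%:R : R) => z M; lra.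
  rewrite !big_nat; apply: lee_sum => t /andP[_]; rewrite ltnS => tN.
  by apply: le_trans UN _; apply: (prob_unsorted_at_nonincreasing comparisonsX).
(* For [L < 2], [n <= 16] and [L ^ 2 <= 4], so the claimed bound is at most 1, the value of the term
   at time 0. *)
apply: le_trans (nneseries_lim_ge 1 _) => //.
rewrite big_nat1 (_ : unsorted_at X x 0 = setT); last first.
  apply/seteqP; split=> // w _; rewrite /unsorted_at /=.
  apply/negP => /sorted_single_one /= n1; by move: n2; rewrite -n1.
rewrite probability_setT lee_fin.
have : n%:R <= 16 :> R.
  rewrite -[leLHS]invrK -[leRHS]invrK lef_pV2 ?posrE ?invr_gt0//.
  rewrite -[n%:R]lnK ?posrE// -expRN.
  rewrite (_ : - L = 4%:R * (- 4^-1 * L)); last by field.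
  rewrite expRM_natl (_ : 16^-1 = 2^-1 ^+ 4 :> R); last by field.
  rewrite lerXn2r ?nnegrE ?expR_ge0 ?invr_ge0//.
  by have := expR_ge1Dx (- 4^-1 * L); lra.
have L0 := ln_ge_half (R := R) n2.
have : L ^+ 2 <= 4 by rewrite expr2; nra.
have : 0 <= L ^+ 2 by rewrite sqr_ge0.
move: n_gt0; rewrite -mulrA; move: (L ^+ 2) (n%:R : R) => l m; nra.
Qed.
End lower_bounds.

Theorem theorem1p5 (R : realType) :
  exists c C gamma : R,
    [/\ 0 < c, c < C, 0 < gamma &
      forall n : nat, (2 <= n)%N ->
        (forall (dT : Order.disp_t) (T : orderType dT) (x : n.-tuple T)
                (d : measure_display) (Omega : measurableType d)
                (P : probability Omega R)
                (X : nat -> Omega -> position_pair n),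
            harmonic_comparisons P X ->
            let tau := fun w : Omega => sorting_time R x (fun t => X t w) in
            (\int[P]_w tau w <= (C * n%:R * ln n%:R ^+ 2)%:E)%E /\
            (P [set w | ((C * n%:R * ln n%:R ^+ 2)%:E < tau w)%E]
               <= (C * n%:R `^ (- gamma))%:E)%E)
        /\
        (exists (dT : Order.disp_t) (T : orderType dT) (x : n.-tuple T),
          forall (d : measure_display) (Omega : measurableType d)
                 (P : probability Omega R)
                 (X : nat -> Omega -> position_pair n),
            harmonic_comparisons P X ->
            let tau := fun w : Omega => sorting_time R x (fun t => X t w) in
            ((c * n%:R * ln n%:R ^+ 2)%:E <= \int[P]_w tau w)%E /\
            (P [set w | (tau w < (c * n%:R * ln n%:R ^+ 2)%:E)%E]
               <= (C * n%:R `^ (- gamma))%:E)%E)].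
Proof.
(* The value 1/64 comes from the small case [n * L ^ 2 <= 64] of the lower mean, 30 from the upper
   mean, and 1/4 from [sorted_bound]. *)
exists 64^-1, 30, 4^-1; split; [lra.. | move=> n n2].
have powE : n%:R `^ (- 4^-1) = expR (- 4^-1 * ln n%:R) :> R.
  by rewrite /powR pnatr_eq0 gtn_eqF// ltnW.
split=> [disp T x d Omega P X comparisonsX tau|].
  split; first exact: expected_sorting_time_le.
  apply: le_trans (prob_sorting_time_gt_le n2 comparisonsX x) _.
  have n_gt0 : 0 < n%:R :> R by rewrite ltr0n ltnW.
  have L_ge := ln_ge_half (R := R) n2.
  rewrite lee_fin powE -[n%:R in leLHS]lnK ?posrE// -expRN.
  apply: (@le_trans _ _ (expR (- 4^-1 * ln n%:R))).
    by rewrite ler_expR; lra.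
  by have := expR_ge0 (- 4^-1 * ln (n%:R : R)); lra.
exists _, bool, (single_one (Ordinal (ltnW n2))) => d Omega P X comparisonsX tau.
by rewrite powE; split; [exact: expected_sorting_time_ge|exact: prob_sorting_time_lt_le].
Qed.
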